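(* Let $k\ge 2$ be an integer. For every admissible index $\boldsymbol{k}$ of weight $k$ there exist integers $c_{\boldsymbol{k};\boldsymbol{l}}\in\mathbb{Z}$ ($\boldsymbol{l}\in\mathbb{I}^{\ge2}_k$) such that \[ \zeta(\boldsymbol{k})=\sum_{\boldsymbol{l}\in\mathbb{I}^{\geq 2}_k}c_{\boldsymbol{k};\boldsymbol{l}}\,\zeta(\boldsymbol{l}). \] In particular, \[ \operatorname{span}_{\mathbb{Z}}\{\zeta(\boldsymbol{k})\mid \boldsymbol{k}\in\mathbb{I}^{\mathrm{adm}}_k\}=\operatorname{span}_{\mathbb{Z}}\{\zeta(\boldsymbol{k})\mid \boldsymbol{k}\in\mathbb{I}^{\geq 2}_k\}. \]
   Context: An index is a finite tuple $\boldsymbol{k}=(k_1,\dots,k_r)$ of positive integers; its weight is $k_1+\cdots+k_r$ and its depth is $r$. It is admissible if $r\ge1$ and $k_r\ge2$. For an admissible index, the multiple zeta value is $\zeta(\boldsymbol{k})=\sum_{0<n_1<\cdots<n_r}n_1^{-k_1}\cdots n_r^{-k_r}$. $\mathbb{I}^{\mathrm{adm}}_k$ denotes the set of admissible indices of weight $k$, and $\mathbb{I}^{\ge2}_k$ the set of indices $(k_1,\dots,k_r)$ of weight $k$ with all $k_i\ge2$. *)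

(* Defs.v *)
From Stdlib Require Import Reals List ZArith Arith.
From Coquelicot Require Import Coquelicot.
Import ListNotations.
Open Scope R_scope.

Definition mzindex := list nat.

Definition weight (ks : mzindex) : nat := List.fold_right Nat.add 0%nat ks.

Definition is_index (ks : mzindex) : Prop := List.Forall (fun k => (1 <= k)%nat) ks.

Definition admissible (ks : mzindex) : Prop :=
  ks <> [] /\ is_index ks /\ (2 <= last ks 0%nat)%nat.

Definition all_ge2 (ks : mzindex) : Prop := List.Forall (fun k => (2 <= k)%nat) ks.

Definition sum_range (f : nat -> R) (a cnt : nat) : R :=
  fold_right Rplus 0 (List.map f (List.seq a cnt)).

(* partial nested sum: sum over m < n_1 < ... < n_r <= N of prod n_i^{-k_i} *)
Fixpoint mzv_partial (m N : nat) (ks : mzindex) : R :=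
  match ks with
  | [] => 1
  | k :: ks' =>
      sum_range (fun n => / (INR n ^ k) * mzv_partial n N ks') (S m) (N - m)
  end.

Definition zeta (ks : mzindex) : R :=
  real (Lim_seq (fun N => mzv_partial 0 N ks)).

Definition in_spanZ (P : mzindex -> Prop) (x : R) : Prop :=
  exists cs : list (Z * mzindex),
    List.Forall (fun p => P (snd p)) cs /\
    x = fold_right Rplus 0 (map (fun p => IZR (fst p) * zeta (snd p)) cs).

(* Main.v *)
Require Import Defs.
From Stdlib Require Import Reals List ZArith Arith Lra Lia.
From Stdlib Require Import FunctionalExtensionality.
From Coquelicot Require Import Coquelicot.
Import ListNotations.
Open Scope R_scope.

(** Encode an index as a word, each entry [k] giving [Y X^(k-1)], and call a
    word admissible if it is empty or starts with [Y] and ends with [X]. For fixed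
    [N], give a summation variable [1 <= n <= N-1] the weight [1/n] if it carries
    the letter [X], and [1/(N-n)] if it carries [Y]. For a word [w] let [f_N(w)]
    and [g_N(w)] be the sums of the products of weights over weakly increasing
    variables, with strict inequality, for [f], at the subwords [XY] and, for
    [g], before every noninitial [Y].

    By the formula of Maesaka, Seki and Watanabe, [g_N] is the multiple harmonic
    sum truncated at [n < N]. In the algebra of noncommutative series it comes
    from [s p^-1 q = q p^-1 s], valid as [s] is a combination of [p] and [q].
    For admissible [w] the difference [f_N(w) - g_N(w)] is
    [O((log N)^(length w) / N)], so that [f_N(w)] also tends to the zeta value.

    The point of [f] is that, for admissible [w],
    [f_(N+1)(w) - f_N(w)] is an integral combination of terms
    [N^-j f_N(v)] with [v] admissible of length [length w - j] and [j >= 2].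
    Indeed the partial fraction [1/(n(N-n)) = (1/n + 1/(N-n))/N] rewrites sums
    with strict inequalities in terms of the sums [e_N] with weak ones; the
    terms in [N^0] and [N^-1] cancel, the latter by telescoping along [w].
    By induction on the length, [f_N(w)] is then an integral combination
    of truncated multiple harmonic sums all of whose entries are at least [2]. *)

(** * Words, weights of the letters, and the weak and partly strict sums *)

Inductive letter := X | Y.
Notation word := (list letter).

(* Sites are counted from the top, [i = N - n]. The sums [esum N i w], [fsum N i w]
   are those over variables [N - i <= n <= N - 1]. *)
Definition xweight (N i : nat) : R := / INR (N - i).
Definition yweight (i : nat) : R := / INR i.
Definition lweight (N i : nat) (a : letter) : R :=
  match a with X => xweight N i | Y => yweight i end.

Fixpoint esum (N i : nat) : word -> R :=
  match i with
  | O => fun w => match w with [] => 1 | _ => 0 end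
  | S i' => fix ew (w : word) : R :=
      match w with
      | [] => 1
      | a :: w' => esum N i' w + lweight N (S i') a * ew w'
      end
  end.

Fixpoint fsum (N i : nat) : word -> R :=
  match i with
  | O => fun w => match w with [] => 1 | _ => 0 end
  | S i' => fix fw (w : word) : R :=
      match w with
      | [] => 1
      | Y :: w' => fsum N i' w + yweight (S i') * fw w'
      | X :: w' => fsum N i' w + xweight N (S i') *
                     match w' with Y :: _ => fsum N i' w' | _ => fw w' end
      end
  end.

Lemma esum_nil N i : esum N i [] = 1.
Proof. destruct i; reflexivity. Qed.

Lemma esum_O N a w : esum N 0 (a :: w) = 0.
Proof. reflexivity. Qed.

Lemma esum_S N i a w :
  esum N (S i) (a :: w) = esum N i (a :: w) + lweight N (S i) a * esum N (S i) w.
Proof. reflexivity. Qed.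

Lemma fsum_nil N i : fsum N i [] = 1.
Proof. destruct i; reflexivity. Qed.

Lemma fsum_O N a w : fsum N 0 (a :: w) = 0.
Proof. reflexivity. Qed.

Lemma fsum_Y N i w :
  fsum N (S i) (Y :: w) = fsum N i (Y :: w) + yweight (S i) * fsum N (S i) w.
Proof. reflexivity. Qed.

Lemma fsum_X N i w :
  fsum N (S i) (X :: w) = fsum N i (X :: w) + xweight N (S i) *
    match w with Y :: _ => fsum N i w | _ => fsum N (S i) w end.
Proof. reflexivity. Qed.

Lemma weights_mul N i : (0 < i < N)%nat ->
  xweight N i * yweight i = / INR N * (xweight N i + yweight i).
Proof.
  intros H; unfold xweight, yweight.
  rewrite minus_INR by lia.
  assert (0 < INR i) by (apply lt_0_INR; lia).
  assert (INR i < INR N) by (apply lt_INR; lia).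
  field; repeat split; lra.
Qed.

(** For goals that are ring identities up to a multiple of [E]: the right side minus the left one is
    [x] times the difference of the sides of [E]. *)
Ltac ring_up_to x E :=
  match type of E with ?a = ?b =>
    match goal with |- ?l = ?r =>
      replace r with (l + x * (a - b)) by ring; rewrite (Rminus_diag_eq a b E); ring
    end
  end.

(* A triple [(z, j, w)] stands for the monomial [z h^j w]. *)
Definition comb := list (Z * nat * word).

(** Polymorphic in the last component: words at first, indices in the reduction. *)
Definition ev {A : Type} (phi : A -> R) (h : R) (c : list (Z * nat * A)) : R :=
  fold_right Rplus 0 (map (fun p => IZR (fst (fst p)) * h ^ snd (fst p) * phi (snd p)) c).

Definition prefix (a : letter) (c : comb) : comb :=
  map (fun p => (fst p, a :: snd p)) c.

Definition mulh {A : Type} (c : list (Z * nat * A)) : list (Z * nat * A) :=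
  map (fun p => (fst (fst p), S (snd (fst p)), snd p)) c.

Definition neg {A : Type} (c : list (Z * nat * A)) : list (Z * nat * A) :=
  map (fun p => ((- fst (fst p))%Z, snd (fst p), snd p)) c.

Lemma ev_app {A} (phi : A -> R) h c d : ev phi h (c ++ d) = ev phi h c + ev phi h d.
Proof.
  unfold ev; induction c as [|p c IH]; simpl; [|rewrite IH]; ring.
Qed.

Lemma ev_neg {A} (phi : A -> R) h c : ev phi h (neg c) = - ev phi h c.
Proof.
  unfold ev; induction c as [|p c IH]; simpl; [ring|].
  rewrite IH, opp_IZR; ring.
Qed.

Lemma ev_mulh {A} (phi : A -> R) h c : ev phi h (mulh c) = h * ev phi h c.
Proof.
  unfold ev; induction c as [|p c IH]; simpl; [ring|].
  rewrite IH; ring.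
Qed.

Lemma ev_prefix (phi : word -> R) h a c : ev phi h (prefix a c) = ev (fun w => phi (a :: w)) h c.
Proof.
  unfold ev; induction c as [|p c IH]; simpl; [ring|].
  rewrite IH; reflexivity.
Qed.

Lemma ev_single (phi : word -> R) h j w : ev phi h [(1%Z, j, w)] = h ^ j * phi w.
Proof. unfold ev; simpl; ring. Qed.

Lemma ev_esum_prefix_O N h a c : ev (esum N 0) h (prefix a c) = 0.
Proof.
  rewrite ev_prefix; unfold ev; induction c as [|p c IH]; simpl; [ring|].
  simpl in IH; rewrite IH; ring.
Qed.

Lemma ev_esum_prefix_S N i h a c :
  ev (esum N (S i)) h (prefix a c) =
  ev (esum N i) h (prefix a c) + lweight N (S i) a * ev (esum N (S i)) h c.
Proof.
  rewrite !ev_prefix; unfold ev; induction c as [|p c IH]; [simpl; ring|].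
  cbn [map fold_right]; rewrite IH, esum_S; ring.
Qed.

Lemma word_ind2 (P : word -> Prop) :
  P [] -> (forall a, P [a]) -> (forall a b w, P w -> P (b :: w) -> P (a :: b :: w)) ->
  forall w, P w.
Proof.
  intros H0 H1 H2 w.
  enough (P w /\ forall a, P (a :: w)) by tauto.
  induction w as [|b w [IH IH']]; split; auto.
Qed.

(** * Expansions in the weak sums *)

(** A strict inequality at [XY] is the weak one minus the diagonal. There both letters share a site,
    and [weights_mul] turns the product of their weights into [h] times the sum of the two: [XY]
    merges into [X] or [Y]. *)
Fixpoint fexp (w : word) : comb :=
  match w with
  | [] => [(1%Z, O, [])]
  | Y :: w' => prefix Y (fexp w')
  | X :: w' => prefix X (fexp w') ++
      match w' with
      | Y :: w'' => mulh (neg (prefix X (fexp w'') ++ prefix Y (fexp w'')))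
      | _ => []
      end
  end.

Lemma fsum_fexp N i w : (i < N)%nat -> fsum N i w = ev (esum N i) (/ INR N) (fexp w).
Proof.
  revert i; induction w as [|a|a b w IH0 IH] using word_ind2; intros i Hi.
  - cbn [fexp]; rewrite ev_single, fsum_nil, esum_nil; simpl; ring.
  - induction i as [|i IHi].
    + destruct a; simpl fexp; unfold ev; simpl; ring.
    + destruct a.
      * rewrite fsum_X, IHi, fsum_nil by lia; simpl fexp.
        unfold ev; cbn [map fold_right fst snd pow].
        rewrite esum_S, esum_nil; cbn [lweight]; ring.
      * rewrite fsum_Y, IHi, fsum_nil by lia; simpl fexp.
        unfold ev; cbn [map fold_right fst snd pow].
        rewrite esum_S, esum_nil; cbn [lweight]; ring.
  (* Covers every first pair with a weak inequality, that is, all but [XY]. *)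
  - assert (HY : forall a', (forall i, fsum N (S i) (a' :: b :: w) =
          fsum N i (a' :: b :: w) + lweight N (S i) a' * fsum N (S i) (b :: w)) ->
        fexp (a' :: b :: w) = prefix a' (fexp (b :: w)) ->
        fsum N i (a' :: b :: w) = ev (esum N i) (/ INR N) (fexp (a' :: b :: w))).
    { intros a' Hrec ->; induction i as [|i IHi].
      - rewrite ev_esum_prefix_O; reflexivity.
      - rewrite Hrec, ev_esum_prefix_S, IHi, IH by lia; ring. }
    destruct a; [destruct b|].
    + apply HY; [intros; apply fsum_X|]. cbn [fexp]; rewrite app_nil_r; reflexivity.
    + clear HY.
      change (fexp (X :: Y :: w)) with (prefix X (fexp (Y :: w)) ++
        mulh (neg (prefix X (fexp w) ++ prefix Y (fexp w)))).
      rewrite ev_app, ev_mulh, ev_neg, ev_app.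
      induction i as [|i IHi].
      * rewrite !ev_esum_prefix_O; simpl; ring.
      * rewrite !ev_esum_prefix_S, fsum_X, IHi by lia.
        rewrite <- !IH, <- !IH0, (fsum_Y N i w) by lia; cbn [lweight].
        pose proof (weights_mul N (S i) ltac:(lia)) as E.
        ring_up_to (fsum N (S i) w) E.
    + apply HY; [intros; apply fsum_Y|reflexivity].
Qed.

(* With [m = N - i], this is the sum over variables [m <= n] of level [N] in
   which those of [Y] range up to [N - 1] and those of [X] up to [N], the
   inequality being strict exactly at the subwords [YX]: shifting the variables
   of [Y] by one turns [fsum] of level [N + 1] into it. *)
Definition tsum (N i : nat) (w : word) : R :=
  match w with Y :: _ => fsum (S N) i w | _ => fsum (S N) (S i) w end.

Definition allX (w : word) : bool :=
  forallb (fun a => match a with X => true | Y => false end) w.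

Lemma tsum_nil N i : tsum N i [] = 1.
Proof. reflexivity. Qed.

Lemma tsum_X_O N w : tsum N 0 (X :: w) = / INR N * tsum N 0 w.
Proof.
  unfold tsum; rewrite fsum_X, fsum_O; unfold xweight.
  replace (S N - 1)%nat with N by lia.
  destruct w as [|[] w]; ring.
Qed.

Lemma tsum_X_S N i w :
  tsum N (S i) (X :: w) = tsum N i (X :: w) + xweight N (S i) * tsum N (S i) w.
Proof.
  unfold tsum; rewrite (fsum_X (S N) (S i)); unfold xweight.
  replace (S N - S (S i))%nat with (N - S i)%nat by lia.
  destruct w as [|[] w]; reflexivity.
Qed.

Lemma tsum_Y_S N i w :
  tsum N (S i) (Y :: w) = tsum N i (Y :: w) + yweight (S i) *
    match w with X :: _ => tsum N i w | _ => tsum N (S i) w end.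
Proof.
  unfold tsum; rewrite fsum_Y.
  destruct w as [|[] w]; reflexivity.
Qed.

(** At [i = 0] the only place left is [n = N], open to [X] alone and of weight [1/N]. *)
Lemma tsum_O N w : tsum N 0 w = if allX w then (/ INR N) ^ length w else 0.
Proof.
  induction w as [|[] w IH]; [reflexivity| |reflexivity].
  rewrite tsum_X_O, IH; simpl allX; destruct (allX w); simpl; ring.
Qed.

(** Either the last variable equals [N], with weight [1/N], or all of them stay below [N]. *)
Lemma tsum_allX N i w : allX w = true -> (i < N)%nat ->
  tsum N i (X :: w) = / INR N * tsum N i w + esum N i (X :: w).
Proof.
  revert i; induction w as [|[] w IH]; intros i Hw Hi; [| |discriminate];
    (induction i as [|i IHi]; [rewrite tsum_X_O, esum_O; ring|]);
    rewrite tsum_X_S, IHi, esum_S by lia; cbn [lweight].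
  - rewrite !tsum_nil, esum_nil; ring.
  - rewrite (IH (S i) Hw Hi) at 1.
    rewrite tsum_X_S; ring.
Qed.

(* In the case [Y :: X :: w''] with [w''] a power of [X], [tsum_allX] is used to
   keep only words ending in [X]. *)
Fixpoint texp (w : word) : comb :=
  match w with
  | [] => [(1%Z, O, [])]
  | X :: w' => prefix X (texp w') ++
      (if allX w' then [(1%Z, S (length w'), [])] else [])
  | Y :: w' =>
      match w' with
      | X :: w'' =>
          if allX w'' then [(1%Z, O, w)] ++ mulh (neg (prefix X (texp w'')))
          else prefix Y (texp w') ++ mulh (neg (prefix X (texp w'') ++ prefix Y (texp w'')))
      | _ => prefix Y (texp w')
      end
  end.

Lemma tsum_texp N i w : (i < N)%nat -> tsum N i w = ev (esum N i) (/ INR N) (texp w).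
Proof.
  (* Both tails are carried along because [texp] strips two letters at [YX]. *)
  enough (forall w, (forall i, (i < N)%nat -> tsum N i w = ev (esum N i) (/ INR N) (texp w)) /\
    forall a i, (i < N)%nat -> tsum N i (a :: w) = ev (esum N i) (/ INR N) (texp (a :: w)))
    as H by apply H.
  clear i w; induction w as [|b w [IH0 IH]].
  - split.
    + intros i Hi; cbn [texp]; rewrite ev_single, tsum_nil, esum_nil; simpl; ring.
    + intros a i Hi; induction i as [|i IHi].
      * rewrite tsum_O; destruct a; unfold ev; simpl; ring.
      * destruct a; [rewrite tsum_X_S|rewrite tsum_Y_S]; rewrite IHi, tsum_nil by lia;
          simpl texp; unfold ev; cbn [map fold_right fst snd pow];
          rewrite ?esum_S, !esum_nil; cbn [lweight]; ring.
  - split; [intros i Hi; apply IH; exact Hi|].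
    intros [] i Hi.
    + change (texp (X :: b :: w)) with (prefix X (texp (b :: w)) ++
        (if allX (b :: w) then [(1%Z, S (length (b :: w)), [])] else [])).
      rewrite ev_app; induction i as [|i IHi].
      * rewrite ev_esum_prefix_O, tsum_O; change (allX (X :: b :: w)) with (allX (b :: w)).
        destruct (allX (b :: w)); [rewrite ev_single, esum_nil; cbn [length]; ring|].
        unfold ev; simpl; ring.
      * rewrite tsum_X_S, ev_esum_prefix_S, IHi, IH by lia.
        cbn [lweight].
        destruct (allX (b :: w)); [rewrite !ev_single, !esum_nil|unfold ev]; simpl; ring.
    + destruct b.
      * change (texp (Y :: X :: w)) with
          (if allX w then [(1%Z, O, Y :: X :: w)] ++ mulh (neg (prefix X (texp w)))
           else prefix Y (texp (X :: w)) ++ mulh (neg (prefix X (texp w) ++ prefix Y (texp w)))).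
        destruct (allX w) eqn:Hw.
        -- rewrite ev_app, ev_single, ev_mulh, ev_neg; induction i as [|i IHi].
           ++ rewrite ev_esum_prefix_O, tsum_O, esum_O; simpl; ring.
           ++ rewrite tsum_Y_S, IHi, ev_esum_prefix_S, esum_S, <- IH0 by lia; cbn [lweight].
              (* For the weights [x], [y] and [h = 1/N], the relation [x y = h (x + y)] gives
                 [y (h - x) = - h x], so only the merger into [X] survives. *)
              pose proof (tsum_allX N (S i) w Hw Hi) as E; rewrite tsum_X_S in E.
              pose proof (weights_mul N (S i) ltac:(lia)) as E2.
              replace (tsum N i (X :: w)) with
                (/ INR N * tsum N (S i) w + esum N (S i) (X :: w)
                 - xweight N (S i) * tsum N (S i) w) by (rewrite <- E; ring).
              ring_up_to (tsum N (S i) w) E2.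
        -- rewrite ev_app, ev_mulh, ev_neg, ev_app; induction i as [|i IHi].
           ++ rewrite !ev_esum_prefix_O, tsum_O; simpl; ring.
           ++ rewrite tsum_Y_S, IHi, !ev_esum_prefix_S, <- IH0, <- IH, (tsum_X_S N i w) by lia.
              cbn [lweight].
              pose proof (weights_mul N (S i) ltac:(lia)) as E2.
              ring_up_to (tsum N (S i) w) E2.
      * change (texp (Y :: Y :: w)) with (prefix Y (texp (Y :: w))).
        induction i as [|i IHi].
        -- rewrite ev_esum_prefix_O; apply tsum_O.
        -- rewrite tsum_Y_S, ev_esum_prefix_S, IHi, IH by lia; reflexivity.
Qed.

(** Expands the complete [fsum] of the next level in weak sums of the present one. The first [Y]
    either sits at [n = 1], where its weight is [h], or beyond, which is [tsum]. At [YX] the two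
    contributions to [h X texp(w'')] cancel, so no word starting with [X] is left. *)
Fixpoint uexp (w : word) : comb :=
  match w with
  | Y :: w' =>
      match w' with
      | Y :: _ => mulh (uexp w') ++ prefix Y (texp w')
      | X :: w'' =>
          if allX w'' then [(1%Z, O, w); (1%Z, length w, [])]
          else prefix Y (prefix X (texp w'')) ++ mulh (neg (prefix Y (texp w'')))
      | [] => []
      end
  | _ => []
  end.

(** The default [Y] makes the empty word fail. *)
Definition endsX (w : word) : Prop := last w Y = X.

Lemma fsum_uexp N w : endsX (Y :: w) ->
  fsum (S (S N)) (S N) (Y :: w) = ev (esum (S N) N) (/ INR (S N)) (uexp (Y :: w)).
Proof.
  assert (Hstart : forall w, fsum (S (S N)) (S N) (Y :: w) =
    tsum (S N) N (Y :: w) + / INR (S N) * fsum (S (S N)) (S N) w).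
  { intros; apply fsum_Y. }
  induction w as [|[] w IH]; intros Hw; [discriminate| |].
  - rewrite Hstart.
    change (fsum (S (S N)) (S N) (X :: w)) with (tsum (S N) N (X :: w)).
    rewrite !tsum_texp by lia.
    cbn [uexp]; cbn [texp].
    destruct (allX w) eqn:Ew.
    + rewrite !ev_app, ev_mulh, ev_neg, !ev_single, esum_nil.
      unfold ev at 3; cbn [map fold_right fst snd pow length]; rewrite esum_nil; ring.
    + rewrite !app_nil_r, !ev_app, !ev_mulh, !ev_neg, !ev_app; ring.
  - rewrite Hstart, IH, tsum_texp by (assumption || lia).
    change (uexp (Y :: Y :: w)) with (mulh (uexp (Y :: w)) ++ prefix Y (texp (Y :: w))).
    rewrite ev_app, ev_mulh; change (texp (Y :: Y :: w)) with (prefix Y (texp (Y :: w))); ring.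
Qed.

(** * Homogeneity and admissibility of the expansions *)

Definition homog (k : nat) (P : word -> Prop) (c : comb) : Prop :=
  List.Forall (fun p => (snd (fst p) + length (snd p) = k)%nat /\ P (snd p)) c.

Lemma homog_app k P c d : homog k P c -> homog k P d -> homog k P (c ++ d).
Proof. intros; apply Forall_app; split; assumption. Qed.

Lemma homog_prefix k (P Q : word -> Prop) a c :
  (forall v, P v -> Q (a :: v)) -> homog k P c -> homog (S k) Q (prefix a c).
Proof.
  intros HPQ Hc; apply Forall_map; refine (Forall_impl _ _ Hc).
  intros p [E H]; split; [cbn; rewrite ?Nat.add_succ_r; f_equal; exact E|cbn; auto].
Qed.

Lemma homog_mulh k P c : homog k P c -> homog (S k) P (mulh c).
Proof.
  intros Hc; apply Forall_map; refine (Forall_impl _ _ Hc).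
  intros p [E H]; split; [cbn; rewrite ?Nat.add_succ_r; f_equal; exact E|cbn; auto].
Qed.

Lemma homog_neg k P c : homog k P c -> homog k P (neg c).
Proof.
  intros Hc; apply Forall_map; refine (Forall_impl _ _ Hc); auto.
Qed.

Lemma homog_single k (P : word -> Prop) j v : (j + length v = k)%nat -> P v -> homog k P [(1%Z, j, v)].
Proof. intros; constructor; [split; assumption|constructor]. Qed.

Lemma endsX_cons a v : endsX v -> endsX (a :: v).
Proof. destruct v; [discriminate|exact (fun H => H)]. Qed.

Lemma endsX_tail_Y v : endsX (Y :: v) -> endsX v.
Proof. destruct v; [discriminate|exact (fun H => H)]. Qed.

Lemma allX_endsX w : allX w = true -> endsX (X :: w).
Proof.
  induction w as [|[] w IH]; [reflexivity|exact IH|discriminate].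
Qed.

Lemma fexp_homog w : endsX w -> homog (length w) endsX (fexp w).
Proof.
  induction w as [|a|a b w IH0 IH] using word_ind2; intros Hw; [discriminate| |].
  - destruct a; [|discriminate]; simpl; apply homog_single; auto.
  - pose proof (homog_prefix _ _ _ a _ (endsX_cons a) (IH Hw)) as Hp.
    destruct a; [destruct b|]; [|..|exact Hp].
    + cbn [fexp]; rewrite app_nil_r; exact Hp.
    + specialize (IH0 (endsX_tail_Y _ Hw)).
      cbn [fexp]; apply homog_app; [exact Hp|].
      apply homog_mulh, homog_neg, homog_app; (eapply homog_prefix; [apply endsX_cons|exact IH0]).
Qed.

(** The expansion of a power of [X] contains the empty word, which does not end in [X]; where
    [texp_homog] uses it, an [X] stands in front. *)
Lemma texp_allX_homog w : allX w = true ->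
  homog (length w) (fun v => endsX (X :: v)) (texp w).
Proof.
  induction w as [|[] w IH]; intros Hw; [| |discriminate].
  - apply homog_single; reflexivity.
  - change (allX (X :: w)) with (allX w) in Hw; cbn [texp]; rewrite Hw.
    apply homog_app.
    + eapply homog_prefix; [|apply IH, Hw]; intros v; apply endsX_cons.
    + apply homog_single; [apply Nat.add_0_r|reflexivity].
Qed.

Lemma texp_homog w : endsX w -> allX w = false -> homog (length w) endsX (texp w).
Proof.
  induction w as [|a|a b w IH0 IH] using word_ind2; intros Hw Ha; [discriminate| |].
  - destruct a; discriminate.
  - destruct a; [|destruct b].
    + change (allX (X :: b :: w)) with (allX (b :: w)) in Ha.
      change (texp (X :: b :: w)) with (prefix X (texp (b :: w)) ++
        (if allX (b :: w) then [(1%Z, S (length (b :: w)), [])] else [])).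
      rewrite Ha, app_nil_r.
      eapply homog_prefix; [apply endsX_cons|apply IH; assumption].
    + change (texp (Y :: X :: w)) with
        (if allX w then [(1%Z, O, Y :: X :: w)] ++ mulh (neg (prefix X (texp w)))
         else prefix Y (texp (X :: w)) ++ mulh (neg (prefix X (texp w) ++ prefix Y (texp w)))).
      destruct (allX w) eqn:E.
      * apply homog_app; [apply homog_single; [reflexivity|exact Hw]|].
        apply homog_mulh, homog_neg.
        eapply homog_prefix; [|apply texp_allX_homog, E]; auto.
      * assert (Hw' : endsX w) by (destruct w; [discriminate|exact Hw]).
        apply homog_app; [eapply homog_prefix; [apply endsX_cons|apply IH; assumption]|].
        apply homog_mulh, homog_neg, homog_app;
          (eapply homog_prefix; [apply endsX_cons|apply IH0; assumption]).
    + eapply homog_prefix; [apply endsX_cons|apply IH; [exact Hw|reflexivity]].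
Qed.

Definition adm (v : word) : Prop := v = [] \/ exists v', v = Y :: v' /\ endsX v'.

Lemma adm_cons v : endsX v -> adm (Y :: v).
Proof. right; eauto. Qed.

Lemma uexp_homog w : endsX (Y :: w) -> homog (length (Y :: w)) adm (uexp (Y :: w)).
Proof.
  induction w as [|[] w IH]; intros Hw; [discriminate| |].
  - change (uexp (Y :: X :: w)) with
      (if allX w then [(1%Z, O, Y :: X :: w); (1%Z, length (Y :: X :: w), [])]
       else prefix Y (prefix X (texp w)) ++ mulh (neg (prefix Y (texp w)))).
    destruct (allX w) eqn:E.
    + apply (homog_app _ _ [_] [_]); apply homog_single.
      * reflexivity.
      * apply adm_cons, allX_endsX, E.
      * apply Nat.add_0_r.
      * left; reflexivity.
    + assert (Hw' : endsX w) by (destruct w; [discriminate|exact Hw]).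
      pose proof (texp_homog w Hw' E) as H.
      apply homog_app.
      * eapply homog_prefix; [apply adm_cons|]; eapply homog_prefix; [apply endsX_cons|exact H].
      * apply homog_mulh, homog_neg; eapply homog_prefix; [apply adm_cons|exact H].
  - change (uexp (Y :: Y :: w)) with (mulh (uexp (Y :: w)) ++ prefix Y (texp (Y :: w))).
    apply homog_app; [apply homog_mulh, IH, Hw|].
    eapply homog_prefix; [apply adm_cons|exact (texp_homog (Y :: w) Hw eq_refl)].
Qed.

(** * Coefficients of order zero and one in [h] *)

(** Quantifying over [phi] compares formal coefficients and lets an induction absorb the first
    letter into [phi]. *)
Definition coef (j : nat) (phi : word -> R) (c : comb) : R :=
  fold_right Rplus 0
    (map (fun p => if Nat.eqb (snd (fst p)) j then IZR (fst (fst p)) * phi (snd p) else 0) c).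

Lemma coef_nil j phi : coef j phi [] = 0.
Proof. reflexivity. Qed.

Lemma coef_app j phi c d : coef j phi (c ++ d) = coef j phi c + coef j phi d.
Proof.
  unfold coef; induction c as [|p c IH]; simpl; [|rewrite IH]; ring.
Qed.

Lemma coef_neg j phi c : coef j phi (neg c) = - coef j phi c.
Proof.
  unfold coef; induction c as [|p c IH]; simpl; [ring|].
  rewrite IH, opp_IZR; destruct (Nat.eqb _ _); ring.
Qed.

Lemma coef_mulh_O phi c : coef 0 phi (mulh c) = 0.
Proof.
  unfold coef; induction c as [|p c IH]; simpl; [|rewrite IH]; ring.
Qed.

Lemma coef_mulh_S j phi c : coef (S j) phi (mulh c) = coef j phi c.
Proof.
  unfold coef; induction c as [|p c IH]; simpl; [|rewrite IH]; reflexivity.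
Qed.

Lemma coef_prefix j phi a c : coef j phi (prefix a c) = coef j (fun w => phi (a :: w)) c.
Proof.
  unfold coef; induction c as [|p c IH]; simpl; [|rewrite IH]; reflexivity.
Qed.

Lemma coef_single i j phi w :
  coef i phi [(1%Z, j, w)] = if Nat.eqb j i then phi w else 0.
Proof. unfold coef; simpl; destruct (Nat.eqb j i); ring. Qed.

Lemma fexp_coef_O phi w : coef 0 phi (fexp w) = phi w.
Proof.
  revert phi; induction w as [|[] w IH]; intros phi; cbn [fexp].
  - apply coef_single.
  - rewrite coef_app, coef_prefix, IH.
    destruct w as [|[] w]; [..|rewrite coef_mulh_O]; rewrite ?coef_nil; ring.
  - rewrite coef_prefix; apply IH.
Qed.

Lemma texp_coef_O phi w : coef 0 phi (texp w) = phi w.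
Proof.
  revert phi; induction w as [|[] w IH]; intros phi; cbn [texp].
  - apply coef_single.
  - rewrite coef_app, coef_prefix, IH.
    destruct (allX w); [rewrite coef_single|rewrite coef_nil]; simpl; ring.
  - destruct w as [|[] w].
    + apply coef_single.
    + destruct (allX w); rewrite coef_app, coef_mulh_O.
      * rewrite coef_single; simpl; ring.
      * rewrite coef_prefix, IH; ring.
    + rewrite coef_prefix; apply IH.
Qed.

Lemma uexp_coef_O phi w : endsX (Y :: w) -> coef 0 phi (uexp (Y :: w)) = phi (Y :: w).
Proof.
  destruct w as [|[] w]; intros Hw; [discriminate|..].
  - cbn [uexp]; destruct (allX w).
    + unfold coef; simpl; ring.
    + rewrite coef_app, coef_mulh_O, !coef_prefix, texp_coef_O; ring.
  - change (uexp (Y :: Y :: w)) with (mulh (uexp (Y :: w)) ++ prefix Y (texp (Y :: w))).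
    rewrite coef_app, coef_mulh_O, coef_prefix, texp_coef_O; ring.
Qed.

Lemma fexp_allX w : allX w = true -> fexp (X :: w) = [(1%Z, O, X :: w)].
Proof.
  induction w as [|[] w IH]; intros Hw; [reflexivity| |discriminate].
  change (fexp (X :: X :: w)) with (prefix X (fexp (X :: w)) ++ []).
  rewrite IH by exact Hw; reflexivity.
Qed.

(* To first order in [h], the expansions [fexp] and [texp] are sums over
   deletions of one letter; these telescope along [w], because deleting either
   of two equal adjacent letters gives the same word. Only the deletion of the
   first letter survives. *)
Lemma texp_fexp_coef_1 phi a w : endsX (a :: w) ->
  coef 1 phi (texp (a :: w)) =
  coef 1 phi (fexp (a :: w)) + match a with X => phi w | Y => - phi w end.
Proof.
  revert phi a; induction w as [|b w IH]; intros phi a Hw.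
  - destruct a; [|discriminate]; unfold coef; simpl; ring.
  - specialize (IH (fun v => phi (a :: v)) b Hw).
    destruct a; [|destruct b].
    + change (texp (X :: b :: w)) with (prefix X (texp (b :: w)) ++
        (if allX (b :: w) then [(1%Z, S (length (b :: w)), [])] else [])).
      rewrite coef_app, coef_prefix, IH.
      (* The pure power of [h] has exponent at least two, as [b :: w] is not empty. *)
      replace (coef 1 phi (if allX (b :: w) then _ else _)) with 0
        by (destruct (allX (b :: w)); [rewrite coef_single|]; reflexivity).
      cbn [fexp]; rewrite coef_app, coef_prefix; destruct b.
      * rewrite coef_nil; ring.
      * rewrite coef_mulh_S, coef_neg, coef_app, !coef_prefix, fexp_coef_O, fexp_coef_O; ring.
    + change (texp (Y :: X :: w)) with
        (if allX w then [(1%Z, O, Y :: X :: w)] ++ mulh (neg (prefix X (texp w)))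
         else prefix Y (texp (X :: w)) ++ mulh (neg (prefix X (texp w) ++ prefix Y (texp w)))).
      change (fexp (Y :: X :: w)) with (prefix Y (fexp (X :: w))); rewrite (coef_prefix 1 phi Y).
      destruct (allX w) eqn:E; rewrite coef_app, coef_mulh_S, coef_neg.
      * rewrite coef_single, coef_prefix, texp_coef_O; simpl Nat.eqb; cbv iota.
        rewrite (fexp_allX _ E); unfold coef; simpl; ring.
      * rewrite coef_prefix, IH, coef_app, !coef_prefix, !texp_coef_O; ring.
    + change (texp (Y :: Y :: w)) with (prefix Y (texp (Y :: w))).
      change (fexp (Y :: Y :: w)) with (prefix Y (fexp (Y :: w))).
      rewrite !coef_prefix, IH; ring.
Qed.

(** In [texp_fexp_coef_1] the deletion of the first letter is left over. For [YX] the term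
    [- h Y texp(w'')] removes it, for [YY] the leading term of [mulh (uexp w')] does. *)
Lemma uexp_coef_1 phi w : endsX (Y :: w) ->
  coef 1 phi (uexp (Y :: w)) = coef 1 phi (fexp (Y :: w)).
Proof.
  destruct w as [|[] w]; intros Hw; [discriminate|..].
  - change (fexp (Y :: X :: w)) with (prefix Y (fexp (X :: w))); rewrite coef_prefix.
    pose proof (texp_fexp_coef_1 (fun v => phi (Y :: v)) X w Hw) as E.
    cbn [uexp]; cbn [texp] in E; destruct (allX w) eqn:Ew.
    + rewrite (fexp_allX _ Ew); unfold coef; simpl; ring.
    + rewrite app_nil_r, coef_prefix in E.
      rewrite coef_app, coef_mulh_S, coef_neg, !coef_prefix, texp_coef_O, E; ring.
  - change (uexp (Y :: Y :: w)) with (mulh (uexp (Y :: w)) ++ prefix Y (texp (Y :: w))).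
    change (fexp (Y :: Y :: w)) with (prefix Y (fexp (Y :: w))).
    rewrite coef_app, coef_mulh_S, !coef_prefix, uexp_coef_O, texp_fexp_coef_1 by exact Hw; ring.
Qed.

Definition truncate {A : Type} (d : nat) (c : list (Z * nat * A)) : list (Z * nat * A) :=
  filter (fun p => Nat.leb d (snd (fst p))) c.

Lemma ev_truncate_1 (phi : word -> R) h c : ev phi h c = coef 0 phi c + ev phi h (truncate 1 c).
Proof.
  unfold ev, coef; induction c as [|[[z [|j]] v] c IH]; simpl; [ring|..];
    rewrite IH; ring.
Qed.

Lemma ev_truncate_2 (phi : word -> R) h c :
  ev phi h c = coef 0 phi c + h * coef 1 phi c + ev phi h (truncate 2 c).
Proof.
  unfold ev, coef; induction c as [|[[z [|[|j]]] v] c IH]; simpl; [ring|..];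
    rewrite IH; ring.
Qed.

Lemma truncate_order {A} d (c : list (Z * nat * A)) :
  List.Forall (fun p => (d <= snd (fst p))%nat) (truncate d c).
Proof.
  apply List.Forall_forall; intros p Hp; apply filter_In in Hp.
  apply Nat.leb_le, Hp.
Qed.

Lemma homog_truncate k P d c : homog k P c -> homog k P (truncate d c).
Proof. intros H; eapply incl_Forall; [apply incl_filter|exact H]. Qed.

Lemma fexp_homog_adm w : adm w -> homog (length w) adm (fexp w).
Proof.
  intros [->|[v [-> Hv]]].
  - apply homog_single; [reflexivity|left; reflexivity].
  - eapply homog_prefix; [apply adm_cons|apply fexp_homog, Hv].
Qed.

Lemma fsum_esum w : adm w -> exists c,
  homog (length w) adm c /\ List.Forall (fun p => (1 <= snd (fst p))%nat) c /\
  forall M, fsum (S M) M w = esum (S M) M w + ev (esum (S M) M) (/ INR (S M)) c.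
Proof.
  intros Hw; exists (truncate 1 (fexp w)); split; [|split].
  - apply homog_truncate, fexp_homog_adm, Hw.
  - apply truncate_order.
  - intros M; rewrite fsum_fexp, ev_truncate_1, fexp_coef_O by lia; reflexivity.
Qed.

(** [uexp] and [fexp] expand the two levels in the same weak sums and agree in orders zero and one,
    so their difference may be truncated at order two. *)
Lemma fsum_increment w : endsX w -> exists c,
  homog (length (Y :: w)) adm c /\ List.Forall (fun p => (2 <= snd (fst p))%nat) c /\
  forall M, fsum (S (S M)) (S M) (Y :: w) - fsum (S M) M (Y :: w) =
    ev (esum (S M) M) (/ INR (S M)) c.
Proof.
  intros Hw.
  assert (Hw' : endsX (Y :: w)) by (apply endsX_cons, Hw).
  exists (truncate 2 (uexp (Y :: w) ++ neg (fexp (Y :: w)))); split; [|split].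
  - apply homog_truncate, homog_app; [apply uexp_homog, Hw'|].
    apply homog_neg, fexp_homog_adm, adm_cons, Hw.
  - apply truncate_order.
  - intros M; rewrite fsum_uexp, fsum_fexp by (assumption || lia).
    match goal with |- ?a - ?b = ?c => transitivity (a + - b); [ring|] end.
    rewrite <- ev_neg, <- ev_app, ev_truncate_2, !coef_app, !coef_neg.
    rewrite uexp_coef_O, uexp_coef_1, fexp_coef_O by exact Hw'; ring.
Qed.

(** * Reduction to indices without ones *)

Lemma sum_range_S f a c : sum_range f a (S c) = f a + sum_range f (S a) c.
Proof. reflexivity. Qed.

Lemma sum_range_last f a c : sum_range f a (S c) = sum_range f a c + f (a + c)%nat.
Proof.
  revert a; induction c as [|c IH]; intros a.
  - unfold sum_range; simpl; rewrite Nat.add_0_r; ring.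
  - rewrite sum_range_S, IH, (sum_range_S f a c), Nat.add_succ_r; simpl; ring.
Qed.

Lemma sum_range_ext f g a c : (forall n, (a <= n < a + c)%nat -> f n = g n) ->
  sum_range f a c = sum_range g a c.
Proof.
  revert a; induction c as [|c IH]; intros a H; [reflexivity|].
  rewrite !sum_range_S, H by lia; f_equal; apply IH; intros; apply H; lia.
Qed.

Lemma sum_range_plus f g a c :
  sum_range (fun n => f n + g n) a c = sum_range f a c + sum_range g a c.
Proof.
  revert a; induction c as [|c IH]; intros a; [unfold sum_range; simpl; ring|].
  rewrite !sum_range_S, IH; ring.
Qed.

Lemma sum_range_mult_r f x a c :
  sum_range (fun n => f n * x) a c = sum_range f a c * x.
Proof.
  revert a; induction c as [|c IH]; intros a; [unfold sum_range; simpl; ring|].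
  rewrite !sum_range_S, IH; ring.
Qed.

Lemma mzv_partial_cons m N k l :
  mzv_partial m N (k :: l) = sum_range (fun n => / (INR n ^ k) * mzv_partial n N l) (S m) (N - m).
Proof. reflexivity. Qed.

Lemma mzv_partial_empty m l : l <> [] -> mzv_partial m m l = 0.
Proof.
  destruct l as [|k l]; [congruence|intros _].
  rewrite mzv_partial_cons, Nat.sub_diag; reflexivity.
Qed.

(** The new value [S N] can only be taken by the last, largest variable. *)
Lemma mzv_partial_snoc m N l j : (m <= N)%nat ->
  mzv_partial m (S N) (l ++ [j]) =
  mzv_partial m N (l ++ [j]) + / (INR (S N) ^ j) * mzv_partial m N l.
Proof.
  revert m; induction l as [|k l IH]; intros m Hm.
  - simpl app; rewrite !mzv_partial_cons, Nat.sub_succ_l, sum_range_last by exact Hm.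
    replace (S m + (N - m))%nat with (S N) by lia; simpl mzv_partial; ring.
  - simpl app; rewrite !mzv_partial_cons, Nat.sub_succ_l, sum_range_last by exact Hm.
    replace (S m + (N - m))%nat with (S N) by lia.
    rewrite (mzv_partial_empty (S N)) by (destruct l; discriminate).
    rewrite Rmult_0_r, Rplus_0_r.
    rewrite (Rmult_comm (/ _)), <- sum_range_mult_r, <- sum_range_plus.
    apply sum_range_ext; intros n Hn; rewrite IH by lia; ring.
Qed.

Definition zspan (k : nat) (a : nat -> R) : Prop :=
  exists c : list (Z * mzindex),
    List.Forall (fun p => all_ge2 (snd p) /\ weight (snd p) = k) c /\
    forall M, a M = fold_right Rplus 0 (map (fun p => IZR (fst p) * mzv_partial 0 M (snd p)) c).

(** The exponent of [1/(M+1)] counts in the weight because it becomes a last entry in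
    [zspan_of_increments]. *)
Definition hspan (d k : nat) (a : nat -> R) : Prop :=
  exists c : list (Z * nat * mzindex),
    List.Forall (fun p => (d <= snd (fst p))%nat /\ all_ge2 (snd p) /\
      (snd (fst p) + weight (snd p) = k)%nat) c /\
    forall M, a M = ev (mzv_partial 0 M) (/ INR (S M)) c.

Lemma hspan_ext d k a b : (forall M, a M = b M) -> hspan d k b -> hspan d k a.
Proof. intros E [c [Hc Eb]]; exists c; split; [exact Hc|intros M; rewrite E; apply Eb]. Qed.

Lemma hspan_0 d k : hspan d k (fun _ => 0).
Proof. exists []; split; [constructor|reflexivity]. Qed.

Lemma hspan_plus d k a b : hspan d k a -> hspan d k b -> hspan d k (fun M => a M + b M).
Proof.
  intros [c [Hc Ea]] [c' [Hc' Eb]]; exists (c ++ c'); split.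
  - apply Forall_app; split; assumption.
  - intros M; rewrite ev_app, Ea, Eb; reflexivity.
Qed.

Lemma hspan_monomial d k a z j : hspan 0 k a -> (d <= j)%nat ->
  hspan d (j + k) (fun M => IZR z * (/ INR (S M)) ^ j * a M).
Proof.
  intros [c [Hc Ea]] Hd.
  exists (map (fun p => ((z * fst (fst p))%Z, (j + snd (fst p))%nat, snd p)) c); split.
  - apply Forall_map; refine (Forall_impl _ _ Hc); intros p [_ [Hp E]]; cbn -[Nat.add].
    repeat split; [lia|exact Hp|]; rewrite <- Nat.add_assoc; f_equal; exact E.
  - intros M; rewrite Ea; generalize (/ INR (S M)); intros h; unfold ev; clear.
    induction c as [|p c IH]; cbn [map fold_right fst snd]; [ring|].
    rewrite <- IH, mult_IZR, pow_add; ring.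
Qed.

Lemma hspan_ev d k (phi : nat -> word -> R) c :
  homog k adm c -> List.Forall (fun p => (d <= snd (fst p))%nat) c ->
  (forall p, In p c -> adm (snd p) -> hspan 0 (length (snd p)) (fun M => phi M (snd p))) ->
  hspan d k (fun M => ev (phi M) (/ INR (S M)) c).
Proof.
  induction c as [|p c IH]; intros Hc Hd Hphi.
  - apply hspan_0.
  - inversion Hc as [|? ? [Ep Hp] Hc']; inversion Hd as [|? ? Hdp Hd']; subst.
    apply hspan_plus.
    + apply hspan_monomial; [apply Hphi; [left; reflexivity|exact Hp]|exact Hdp].
    + apply IH; [exact Hc'|exact Hd'|intros; apply Hphi; [right|]; assumption].
Qed.

Lemma zspan_hspan k a : zspan k a -> hspan 0 k a.
Proof.
  intros [c [Hc Ea]]; exists (map (fun p => (fst p, O, snd p)) c); split.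
  - apply Forall_map; refine (Forall_impl _ _ Hc); intros p [Hp E]; cbn -[Nat.add].
    repeat split; [lia|exact Hp|exact E].
  - intros M; rewrite Ea; unfold ev; clear.
    induction c as [|p c IH]; cbn [map fold_right fst snd pow]; [reflexivity|].
    rewrite IH; ring.
Qed.

Lemma weight_app l l' : weight (l ++ l') = (weight l + weight l')%nat.
Proof. unfold weight; induction l as [|k l IH]; simpl; lia. Qed.

(** By [mzv_partial_snoc], [(M+1)^-j] times the sum for [l] is the increment of the sum for [l ++
    [j]], and the new entry [j] is at least two. *)
Lemma zspan_of_increments k a : a O = 0 -> hspan 2 k (fun M => a (S M) - a M) -> zspan k a.
Proof.
  intros E0 [c [Hc Ea]]; exists (map (fun p => (fst (fst p), snd p ++ [snd (fst p)])) c); split.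
  - apply Forall_map; refine (Forall_impl _ _ Hc); intros p [H2 [Hp E]]; cbn [fst snd]; split.
    + apply Forall_app; split; [exact Hp|constructor; [exact H2|constructor]].
    + rewrite weight_app, Nat.add_comm, <- E; cbn; rewrite Nat.add_0_r; reflexivity.
  - clear Hc; induction M as [|M IH].
    + rewrite E0; clear; induction c as [|p c IH]; [reflexivity|].
      cbn [map fold_right fst snd]; rewrite <- IH, mzv_partial_empty; [ring|].
      apply not_eq_sym, app_cons_not_nil.
    + replace (a (S M)) with (a M + (a (S M) - a M)) by ring; rewrite Ea, IH; clear.
      unfold ev; induction c as [|p c IH]; cbn [map fold_right fst snd]; [ring|].
      rewrite <- IH, mzv_partial_snoc, pow_inv by lia; unfold mzindex in *; ring.
Qed.

(** Strong induction on the length, for [fsum] and [esum] together: increments of [fsum] involve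
    [esum] of words shorter by at least two, and [fsum_esum] then yields [esum] at [w] from [fsum]
    at [w] and shorter words. *)
Lemma fsum_zspan w : adm w -> zspan (length w) (fun M => fsum (S M) M w).
Proof.
  enough (H : adm w -> zspan (length w) (fun M => fsum (S M) M w) /\
                       hspan 0 (length w) (fun M => esum (S M) M w)) by (intros; apply H; assumption).
  remember (length w) as k eqn:Ek; revert w Ek.
  induction k as [k IH] using (well_founded_induction lt_wf); intros w Ek Hw.
  assert (Hz : zspan k (fun M => fsum (S M) M w)).
  { destruct Hw as [->|[v [-> Hv]]].
    - exists [(1%Z, [])]; split.
      + constructor; [|constructor]; split; [constructor|subst; reflexivity].
      + intros M; rewrite fsum_nil; simpl; ring.
    - destruct (fsum_increment v Hv) as [c [Hc [H2 E]]].
      apply zspan_of_increments; [reflexivity|].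
      eapply hspan_ext; [exact E|].
      rewrite <- Ek in Hc; apply hspan_ev; [exact Hc|exact H2|].
      intros p Hp Hadm.
      rewrite List.Forall_forall in H2; specialize (H2 p Hp).
      destruct (proj1 (List.Forall_forall _ _) Hc p Hp) as [El _]; cbv beta in El.
      apply (IH (length (snd p))); [lia|reflexivity|exact Hadm]. }
  split; [exact Hz|].
  destruct (fsum_esum w Hw) as [c [Hc [H1 E]]]; rewrite <- Ek in Hc.
  apply (hspan_ext _ _ _ (fun M => fsum (S M) M w + IZR (-1) * (/ INR (S M)) ^ 0 *
     ev (esum (S M) M) (/ INR (S M)) c)).
  { intros M; rewrite E; simpl; ring. }
  apply hspan_plus; [apply zspan_hspan, Hz|].
  apply (hspan_monomial 0 k (fun M => ev (esum (S M) M) (/ INR (S M)) c) (-1) 0); [|lia].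
  apply hspan_ev; [exact Hc|apply List.Forall_forall; intros; lia|].
  intros p Hp Hadm.
  rewrite List.Forall_forall in H1; specialize (H1 p Hp).
  destruct (proj1 (List.Forall_forall _ _) Hc p Hp) as [El _]; cbv beta in El.
  apply (IH (length (snd p))); [lia|reflexivity|exact Hadm].
Qed.

(** * A discretization of multiple zeta values *)

(** A function on words is a noncommutative power series given by its coefficients; this is left
    multiplication by [X]. Likewise [oneY d] multiplies by [1 + d Y] and [geomX c] by
    [(1 - c X)^-1]. *)
Definition lmulX (s : word -> R) (w : word) : R :=
  match w with X :: w' => s w' | _ => 0 end.

Definition lmulY (s : word -> R) (w : word) : R :=
  match w with Y :: w' => s w' | _ => 0 end.

Definition oneY (d : R) (s : word -> R) (w : word) : R := s w + d * lmulY s w.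

Fixpoint geomX (c : R) (s : word -> R) (w : word) : R :=
  s w + match w with X :: w' => c * geomX c s w' | _ => 0 end.

Definition delta (w : word) : R := match w with [] => 1 | _ => 0 end.

(** The product of [(1 + y Y) (1 - x X)^-1] over the sites [i, ..., 1] from left to right, applied
    to [T]; the right factor [T] takes up new factors in the induction. *)
Fixpoint gseries (N i : nat) (T : word -> R) : word -> R :=
  match i with
  | O => T
  | S i' => oneY (yweight (S i')) (geomX (xweight N (S i')) (gseries N i' T))
  end.

Definition shiftXY (N : nat) (s : word -> R) (w : word) : R :=
  s w + / INR N * (lmulY s w - lmulX s w).

(** The factor [1 + (Y/n) (1 - X/n)^-1], in which [Y X^(k-1)] has coefficient [n^-k]. *)
Definition zop (n : nat) (s : word -> R) (w : word) : R :=
  s w + / INR n * lmulY (geomX (/ INR n) s) w.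

Lemma shiftXY_geomX N T : shiftXY N (geomX (/ INR N) T) = zop N T.
Proof.
  apply functional_extensionality; intros [|[] w]; unfold shiftXY, zop; simpl; ring.
Qed.

Lemma weights_inv N i : (0 < i < N)%nat ->
  exists x y : R, 0 < x /\ 0 < y /\ xweight N i = / x /\ yweight i = / y /\ INR N = x + y.
Proof.
  intros H; exists (INR (N - i)), (INR i).
  repeat split; try (apply lt_0_INR; lia).
  rewrite <- plus_INR; f_equal; lia.
Qed.

(* Put [p = 1 - c X], [q = 1 + d Y] for the weights [c], [d] of a site. Then
   [1 + (Y - X) / N] is a convex combination of [p] and [q], so that it
   intertwines [p^-1 q] and [q p^-1]. *)
Lemma geomX_shiftXY N i s w : (0 < i < N)%nat ->
  geomX (xweight N i) (shiftXY N s) w =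
  yweight i / (xweight N i + yweight i) * s w +
  xweight N i / (xweight N i + yweight i) * geomX (xweight N i) (oneY (yweight i) s) w.
Proof.
  intros H; destruct (weights_inv N i H) as (x & y & Hx & Hy & -> & -> & HN).
  induction w as [|[] w IH]; cbn [geomX]; [|rewrite IH|];
    unfold shiftXY, oneY; simpl lmulX; simpl lmulY; rewrite ?HN; field; repeat split; lra.
Qed.

(** With the multiplier of [shiftXY] written [a p + b q], both sides are multiplication by
    [a q + b q p^-1 q]. *)
Lemma shiftXY_intertwine N i s : (0 < i < N)%nat ->
  shiftXY N (geomX (xweight N i) (oneY (yweight i) s)) =
  oneY (yweight i) (geomX (xweight N i) (shiftXY N s)).
Proof.
  intros H; apply functional_extensionality; intros w.
  unfold oneY at 2; rewrite geomX_shiftXY by exact H.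
  destruct w as [|[] w]; unfold lmulY; try rewrite geomX_shiftXY by exact H;
    unfold shiftXY; destruct (weights_inv N i H) as (x & y & Hx & Hy & -> & -> & HN);
    cbn [geomX lmulX lmulY]; rewrite ?HN; unfold oneY; cbn [lmulY]; field; repeat split; lra.
Qed.

(** [gseries] of level [N + 1] without its first factor [1 + y Y], regrouped into pairs [p^-1 q] of
    level [N]: the [X] weight of site [i + 1] at level [N + 1] is that of site [i] at level [N]. *)
Fixpoint aseries (N i : nat) (T : word -> R) : word -> R :=
  match i with
  | O => geomX (/ INR N) T
  | S i' => geomX (xweight N (S i')) (oneY (yweight (S i')) (aseries N i' T))
  end.

Lemma gseries_aseries N i T : gseries (S N) (S i) T = oneY (yweight (S i)) (aseries N i T).
Proof.
  induction i as [|i IH].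
  - cbn [gseries aseries]; unfold xweight; replace (S N - 1)%nat with N by lia; reflexivity.
  - change (gseries (S N) (S (S i)) T) with
      (oneY (yweight (S (S i))) (geomX (xweight (S N) (S (S i))) (gseries (S N) (S i) T))).
    rewrite IH; reflexivity.
Qed.

Lemma shiftXY_aseries N i T : (i < N)%nat ->
  shiftXY N (aseries N i T) = gseries N i (zop N T).
Proof.
  induction i as [|i IH]; intros Hi; [apply shiftXY_geomX|].
  cbn [aseries gseries]; rewrite shiftXY_intertwine, IH by lia; reflexivity.
Qed.

Definition startsX (w : word) : bool := match w with X :: _ => true | _ => false end.

(** Replacing the first factor [1 + Y/(M+1)] by [1 + (Y - X)/(M+1)] changes only coefficients of
    words starting with [X]; the new factor then moves to the right end and becomes [zop]. *)
Lemma gseries_step M T w : startsX w = false ->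
  gseries (S (S M)) (S M) T w = gseries (S M) M (zop (S M) T) w.
Proof.
  intros Hw; rewrite gseries_aseries, <- shiftXY_aseries by lia.
  destruct w as [|[] w]; [|discriminate|]; unfold oneY, shiftXY, yweight; simpl lmulX;
    simpl lmulY; ring.
Qed.

Fixpoint zseries (a c : nat) (T : word -> R) : word -> R :=
  match c with O => T | S c' => zop a (zseries (S a) c' T) end.

Lemma zseries_last a c T : zseries a (S c) T = zseries a c (zop (a + c) T).
Proof.
  revert a; induction c as [|c IH]; intros a; [rewrite Nat.add_0_r; reflexivity|].
  change (zseries a (S (S c)) T) with (zop a (zseries (S a) (S c) T)).
  rewrite IH, <- Nat.add_succ_comm; reflexivity.
Qed.

(** Generating series form of the formula of Maesaka, Seki and Watanabe. *)
Lemma gseries_zseries M T w : startsX w = false -> gseries (S M) M T w = zseries 1 M T w.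
Proof.
  intros Hw; revert T; induction M as [|M IH]; intros T; [reflexivity|].
  rewrite gseries_step, IH, zseries_last by exact Hw; reflexivity.
Qed.

Fixpoint index_word (ks : mzindex) : word :=
  match ks with [] => [] | k :: ks' => Y :: repeat X (k - 1) ++ index_word ks' end.

Lemma startsX_index_word ks : startsX (index_word ks) = false.
Proof. destruct ks; reflexivity. Qed.

Lemma zseries_X a c w : zseries a c delta (X :: w) = 0.
Proof.
  revert a; induction c as [|c IH]; intros a; [reflexivity|].
  cbn [zseries]; unfold zop; rewrite IH; simpl; ring.
Qed.

Lemma geomX_repeat h s j w : (forall v, s (X :: v) = 0) -> startsX w = false ->
  geomX h s (repeat X j ++ w) = h ^ j * s w.
Proof.
  intros Hs Hw; induction j as [|j IH].
  - destruct w as [|[] w]; [|discriminate|]; simpl; ring.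
  - simpl repeat; cbn [app geomX]; rewrite IH, Hs; simpl; ring.
Qed.

(** A single factor [n] supplies all of [Y X^j], since every factor contributes [1] or a word
    starting with [Y]. *)
Lemma zseries_Y a c j w : startsX w = false ->
  zseries a c delta (Y :: repeat X j ++ w) =
  sum_range (fun n => (/ INR n) ^ S j * zseries (S n) (a + c - S n) delta w) a c.
Proof.
  intros Hw; revert a; induction c as [|c IH]; intros a; [reflexivity|].
  rewrite sum_range_S; cbn [zseries]; unfold zop; cbn [lmulY].
  rewrite IH, geomX_repeat by (apply zseries_X || exact Hw).
  replace (a + S c - S a)%nat with c by lia; rewrite <- Nat.add_succ_comm.
  simpl pow; ring.
Qed.

Lemma mzv_partial_zseries ks m N : is_index ks -> (m <= N)%nat ->
  mzv_partial m N ks = zseries (S m) (N - m) delta (index_word ks).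
Proof.
  intros Hks; revert m; induction Hks as [|k ks Hk Hks IH]; intros m Hm.
  - simpl index_word; generalize (S m), (N - m)%nat; clear; intros a c; revert a.
    induction c as [|c IH]; intros a; [reflexivity|].
    cbn [zseries]; unfold zop; rewrite <- IH; simpl; ring.
  - cbn [index_word]; rewrite zseries_Y, mzv_partial_cons by apply startsX_index_word.
    apply sum_range_ext; intros n Hn.
    replace (S m + (N - m) - S n)%nat with (N - n)%nat by lia.
    rewrite <- IH, pow_inv by lia; replace (S (k - 1)) with k by lia; reflexivity.
Qed.

Lemma mzv_partial_gseries ks M : is_index ks ->
  mzv_partial 0 M ks = gseries (S M) M delta (index_word ks).
Proof.
  intros H; rewrite gseries_zseries, mzv_partial_zseries by (exact H || lia || apply startsX_index_word).
  rewrite Nat.sub_0_r; reflexivity.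
Qed.

Definition gsum (N i : nat) : word -> R := gseries N i delta.

Lemma gsum_nil N i : gsum N i [] = 1.
Proof.
  unfold gsum; induction i as [|i IH]; [reflexivity|].
  cbn [gseries]; unfold oneY; cbn [geomX lmulY]; rewrite IH; ring.
Qed.

(** What may follow a letter at site [i + 1]: a further [Y] has to move on, while [X] may stay. *)
Lemma geomX_gsum N i w :
  geomX (xweight N (S i)) (gsum N i) w = match w with Y :: _ => gsum N i w | _ => gsum N (S i) w end.
Proof.
  unfold gsum; destruct w as [|[] w]; cbn [gseries]; unfold oneY; simpl lmulY; [ring..|].
  cbn [geomX]; ring.
Qed.

Lemma gsum_X N i w :
  gsum N (S i) (X :: w) = gsum N i (X :: w) + xweight N (S i) *
    match w with Y :: _ => gsum N i w | _ => gsum N (S i) w end.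
Proof.
  rewrite <- geomX_gsum; unfold gsum; cbn [gseries]; unfold oneY; cbn [lmulY geomX]; ring.
Qed.

Lemma gsum_Y N i w :
  gsum N (S i) (Y :: w) = gsum N i (Y :: w) + yweight (S i) *
    match w with Y :: _ => gsum N i w | _ => gsum N (S i) w end.
Proof.
  rewrite <- geomX_gsum; unfold gsum; cbn [gseries]; unfold oneY; cbn [lmulY geomX]; ring.
Qed.

(** * Comparison of the two kinds of sums *)

Fixpoint harm (n : nat) : R := match n with O => 0 | S n' => harm n' + / INR n end.

Lemma harm_S n : harm (S n) = harm n + / INR (S n).
Proof. reflexivity. Qed.

Lemma inv_INR_pos n : (0 < n)%nat -> 0 < / INR n.
Proof. intros; apply Rinv_0_lt_compat, lt_0_INR; assumption. Qed.

Lemma inv_INR_nonneg n : 0 <= / INR n.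
Proof.
  destruct n; [simpl; rewrite Rinv_0; lra|left; apply inv_INR_pos; lia].
Qed.

Lemma lweight_nonneg N i a : 0 <= lweight N i a.
Proof. destruct a; apply inv_INR_nonneg. Qed.

Lemma harm_nonneg n : 0 <= harm n.
Proof.
  induction n as [|n IH]; [apply Rle_refl|].
  pose proof (inv_INR_nonneg (S n)); rewrite harm_S; lra.
Qed.

Lemma harm_le m n : (m <= n)%nat -> harm m <= harm n.
Proof.
  induction 1 as [|n _ IH]; [apply Rle_refl|].
  pose proof (inv_INR_nonneg (S n)); rewrite harm_S; lra.
Qed.

Lemma harm_ge_1 n : (0 < n)%nat -> 1 <= harm n.
Proof.
  intros H; apply Rle_trans with (harm 1); [simpl; rewrite Rinv_1; lra|].
  apply harm_le; exact H.
Qed.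

Lemma esum_letter_S N i a : esum N (S i) [a] = esum N i [a] + lweight N (S i) a.
Proof. rewrite esum_S, esum_nil; ring. Qed.

Lemma esum_letter_nonneg N i a : 0 <= esum N i [a].
Proof.
  induction i as [|i IH]; [apply Rle_refl|].
  rewrite esum_letter_S; pose proof (lweight_nonneg N (S i) a); lra.
Qed.

Lemma esum_letter_le N i a : (i < N)%nat -> esum N i [a] <= harm N.
Proof.
  intros Hi; destruct a.
  (* The added harmonic number completes the sum of the [X] weights to [harm (N - 1)]. *)
  - apply Rle_trans with (esum N i [X] + harm (N - S i)).
    { pose proof (harm_nonneg (N - S i)); lra. }
    apply Rle_trans with (harm (N - 1)); [|apply harm_le; lia].
    right; induction i as [|i IH]; [rewrite esum_O; simpl; ring|].
    rewrite <- IH, esum_letter_S by lia; cbn [lweight]; unfold xweight.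
    replace (N - S i)%nat with (S (N - S (S i))) at 2 by lia; rewrite harm_S.
    replace (S (N - S (S i))) with (N - S i)%nat by lia; ring.
  - apply Rle_trans with (harm i); [|apply harm_le; lia].
    right; clear Hi; induction i as [|i IH]; [reflexivity|].
    rewrite esum_letter_S, IH; reflexivity.
Qed.

Lemma fsum_nonneg N i w : 0 <= fsum N i w.
Proof.
  revert i; induction w as [|a w IH]; intros i; [rewrite fsum_nil; lra|].
  induction i as [|i IHi]; [apply Rle_refl|].
  pose proof (lweight_nonneg N (S i) a) as Ha.
  destruct a; [rewrite fsum_X|rewrite fsum_Y]; apply Rplus_le_le_0_compat; auto;
    apply Rmult_le_pos; auto; destruct w as [|[] w]; apply IH.
Qed.

(** For [i < N], an upper bound for the sum of the [X] weights at the sites up to [i], the largest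
    of which is [xweight N i]. *)
Definition odds (N i : nat) : R := INR i * xweight N i.

Lemma odds_nonneg N i : 0 <= odds N i.
Proof. apply Rmult_le_pos; [apply pos_INR|apply inv_INR_nonneg]. Qed.

Lemma xweight_le N i : (S i < N)%nat -> xweight N i <= xweight N (S i).
Proof.
  intros H; unfold xweight; apply Rinv_le_contravar; [apply lt_0_INR; lia|apply le_INR; lia].
Qed.

Lemma odds_S N i : (S i < N)%nat -> odds N i + xweight N (S i) <= odds N (S i).
Proof.
  intros H; unfold odds; pose proof (xweight_le N i H).
  rewrite S_INR; pose proof (pos_INR i); nra.
Qed.

(** The final [X] contributes at most [odds N i], every other letter at most [harm N]. *)
Lemma fsum_le_odds N i w : endsX w -> (i < N)%nat ->
  fsum N i w <= odds N i * harm N ^ (length w - 1).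
Proof.
  revert i; induction w as [|a w IH]; intros i Hw Hi; [discriminate|].
  destruct w as [|b w].
  - destruct a; [|discriminate]; simpl pow; rewrite Rmult_1_r.
    induction i as [|i IHi]; [unfold odds; simpl; lra|].
    pose proof (odds_S N i Hi); specialize (IHi ltac:(lia)).
    rewrite fsum_X, fsum_nil; lra.
  - specialize (IH) with (1 := Hw).
    replace (length (a :: b :: w) - 1)%nat with (S (length w)) by (simpl; lia).
    replace (length (b :: w) - 1)%nat with (length w) in IH by (simpl; lia).
    pose proof (harm_nonneg N) as HH.
    pose proof (pow_le _ (length w) HH) as HP.
    apply Rle_trans with (esum N i [a] * (odds N i * harm N ^ length w)).
    + induction i as [|i IHi]; [rewrite fsum_O, esum_O; lra|].
      specialize (IHi ltac:(lia)).
      pose proof (odds_S N i Hi) as Ho; pose proof (lweight_nonneg N (S i) X) as Hx.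
      pose proof (lweight_nonneg N (S i) a) as Ha; cbn [lweight] in Hx.
      pose proof (esum_letter_nonneg N i a) as He.
      assert (Hb : forall j, (j = i \/ j = S i) -> fsum N j (b :: w) <= odds N (S i) * harm N ^ length w).
      { intros j Hj; apply Rle_trans with (1 := IH j ltac:(lia)).
        apply Rmult_le_compat_r; [exact HP|destruct Hj; subst; lra]. }
      assert (Hs : fsum N (S i) (a :: b :: w) <=
                   fsum N i (a :: b :: w) + lweight N (S i) a * (odds N (S i) * harm N ^ length w)).
      { destruct a; [rewrite fsum_X|rewrite fsum_Y]; apply Rplus_le_compat_l, Rmult_le_compat_l;
          auto; destruct b; auto. }
      rewrite esum_letter_S.
      assert (esum N i [a] * (odds N i * harm N ^ length w) <=
              esum N i [a] * (odds N (S i) * harm N ^ length w)).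
      { apply Rmult_le_compat_l; [exact He|]. apply Rmult_le_compat_r; [exact HP|lra]. }
      lra.
    + simpl pow; pose proof (esum_letter_le N i a Hi).
      replace (odds N i * (harm N * harm N ^ length w)) with
        (harm N * (odds N i * harm N ^ length w)) by ring.
      apply Rmult_le_compat_r; [|assumption].
      apply Rmult_le_pos; [apply odds_nonneg|exact HP].
Qed.

(* The two sums differ by the terms in which two adjacent [Y]-variables agree.
   Since [w] ends in [X], the remaining variables contribute at most
   [odds N n] times a power of [harm N], and
   [yweight n ^ 2 * odds N n = (xweight N n + yweight n) / N]. *)
Lemma fsum_gsum N i w : endsX w -> (i < N)%nat ->
  0 <= fsum N i w - gsum N i w <= 2 * INR (length w) * / INR N * harm N ^ length w.
Proof.
  revert i; induction w as [|a w IH]; intros i Hw Hi; [discriminate|].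
  assert (HN : 0 < / INR N) by (apply inv_INR_pos; lia).
  assert (HH : 1 <= harm N) by (apply harm_ge_1; lia).
  destruct w as [|b w].
  - destruct a; [|discriminate].
    replace (fsum N i [X] - gsum N i [X]) with 0.
    { simpl; split; [lra|]. assert (0 < harm N) by lra; pose proof (Rmult_lt_0_compat _ _ HN H); lra. }
    symmetry; induction i as [|i IHi]; [unfold gsum; simpl; ring|].
    specialize (IHi ltac:(lia)); rewrite fsum_X, gsum_X, gsum_nil, fsum_nil; lra.
  - specialize (IH) with (1 := Hw).
    pose proof (pow_le (harm N) (length (b :: w)) ltac:(lra)) as HP.
    set (B := 2 * INR (length (b :: w)) * / INR N * harm N ^ length (b :: w)) in *.
    assert (HB : 0 <= B) by (apply (Rle_trans _ _ _ (proj1 (IH i Hi)) (proj2 (IH i Hi)))).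
    set (P := harm N ^ length (b :: w)) in *.
    (* The first term is the error inherited from the tail, the second collects the diagonal terms
       at a leading [YY]. *)
    enough (0 <= fsum N i (a :: b :: w) - gsum N i (a :: b :: w) <=
            esum N i [a] * B + P * (/ INR N * (esum N i [X] + esum N i [Y]))) as [H0 H1].
    { split; [exact H0|]; apply Rle_trans with (1 := H1).
      pose proof (esum_letter_le N i a Hi) as Ea.
      pose proof (esum_letter_le N i X Hi); pose proof (esum_letter_le N i Y Hi).
      apply Rle_trans with (harm N * B + P * (/ INR N * (2 * harm N))).
      - apply Rplus_le_compat; [apply Rmult_le_compat_r; assumption|].
        apply Rmult_le_compat_l; [exact HP|]; apply Rmult_le_compat_l; lra.
      - right; change (length (a :: b :: w)) with (S (length (b :: w))).
        rewrite S_INR; cbn [pow]; fold P; unfold B; ring. }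
    induction i as [|i IHi]; [unfold gsum; simpl; lra|].
    specialize (IHi ltac:(lia)).
    pose proof (IH i ltac:(lia)) as Bi; pose proof (IH (S i) Hi) as BSi.
    pose proof (lweight_nonneg N (S i) X) as Hx; pose proof (lweight_nonneg N (S i) Y) as Hy.
    pose proof (lweight_nonneg N (S i) a) as Ha.
    rewrite !esum_letter_S.
    (* [D] is the error of the tail and [E] the diagonal term, taken to be zero except at [YY]. *)
    assert (Hstep : exists D E, fsum N (S i) (a :: b :: w) - gsum N (S i) (a :: b :: w) =
       fsum N i (a :: b :: w) - gsum N i (a :: b :: w) + lweight N (S i) a * D + E /\
       0 <= D <= B /\ 0 <= E <= P * (/ INR N * (lweight N (S i) X + lweight N (S i) Y))).
    { assert (Hz : 0 <= 0 <= P * (/ INR N * (lweight N (S i) X + lweight N (S i) Y))).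
      { split; [lra|]; apply Rmult_le_pos; [exact HP|]; apply Rmult_le_pos; lra. }
      destruct a; [|destruct b].
      - destruct b.
        + exists (fsum N (S i) (X :: w) - gsum N (S i) (X :: w)), 0.
          rewrite fsum_X, gsum_X; cbn [lweight]; split; [ring|split; assumption].
        + exists (fsum N i (Y :: w) - gsum N i (Y :: w)), 0.
          rewrite fsum_X, gsum_X; cbn [lweight]; split; [ring|split; assumption].
      - exists (fsum N (S i) (X :: w) - gsum N (S i) (X :: w)), 0.
        rewrite fsum_Y, gsum_Y; cbn [lweight]; split; [ring|split; assumption].
      - exists (fsum N i (Y :: w) - gsum N i (Y :: w)),
          (yweight (S i) * (yweight (S i) * fsum N (S i) w)).
        rewrite !fsum_Y, gsum_Y; cbn [lweight]; split; [ring|split; [assumption|]].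
        cbn [lweight] in Hx, Hy.
        pose proof (fsum_nonneg N (S i) w) as Hf.
        split; [repeat apply Rmult_le_pos; assumption|].
        pose proof (fsum_le_odds N (S i) w (endsX_tail_Y _ (endsX_tail_Y _ Hw)) Hi) as Hle.
        assert (HP' : harm N ^ (length w - 1) <= P).
        { apply Rle_pow; [exact HH|simpl; lia]. }
        rewrite <- weights_mul by lia.
        apply Rle_trans with (yweight (S i) * (yweight (S i) * (odds N (S i) * P))).
        + apply Rmult_le_compat_l; [exact Hy|]; apply Rmult_le_compat_l; [exact Hy|].
          apply Rle_trans with (1 := Hle), Rmult_le_compat_l; [apply odds_nonneg|exact HP'].
        + right; unfold odds, yweight; field; apply not_0_INR; lia. }
    destruct Hstep as (D & E & -> & HD & HE).
    assert (0 <= lweight N (S i) a * D <= lweight N (S i) a * B).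
    { split; [apply Rmult_le_pos|apply Rmult_le_compat_l]; lra. }
    lra.
Qed.

(** * Decay of powers of harmonic numbers divided by [N] *)

Lemma harm_le_ln n : (0 < n)%nat -> harm n <= 1 + ln (INR n).
Proof.
  induction 1 as [|n Hn IH]; [simpl; rewrite ln_1, Rinv_1; lra|].
  assert (H0 : 0 < INR n) by (apply lt_0_INR; exact Hn).
  assert (H1 : 0 < INR (S n)) by (apply lt_0_INR; lia).
  (* From [ln t <= t - 1] at [t = n/(n+1)], which bounds [1/(n+1)] by [ln (n+1) - ln n]. *)
  assert (Hl : ln (INR n / INR (S n)) <= INR n / INR (S n) - 1).
  { pose proof (exp_ineq1_le (ln (INR n / INR (S n)))) as H.
    rewrite exp_ln in H by (apply Rdiv_lt_0_compat; assumption); lra. }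
  rewrite ln_div in Hl by assumption.
  replace (INR n / INR (S n) - 1) with (- / INR (S n)) in Hl
    by (rewrite (S_INR n); field; rewrite <- S_INR; lra).
  rewrite harm_S; lra.
Qed.

Lemma pow_le_exp x n : 0 <= x -> x ^ n <= INR (fact n) * exp x.
Proof.
  intros Hx.
  assert (H0 : forall k, 0 <= x ^ k / INR (fact k)).
  { intros k; apply Rdiv_le_0_compat; [apply pow_le, Hx|apply INR_fact_lt_0]. }
  pose proof (exp_ge_taylor x n Hx) as H.
  assert (Hn : x ^ n / INR (fact n) <= sum_f_R0 (fun k => x ^ k / INR (fact k)) n).
  { destruct n as [|n]; [apply Rle_refl|].
    pose proof (cond_pos_sum _ n H0); rewrite tech5; lra. }
  pose proof (INR_fact_lt_0 n).
  apply Rmult_le_reg_r with (/ INR (fact n)); [apply Rinv_0_lt_compat; assumption|].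
  replace (INR (fact n) * exp x * / INR (fact n)) with (exp x) by (field; lra).
  unfold Rdiv in *; lra.
Qed.

(** For [m = M + 1] and [y = 1 + ln m], [pow_le_exp] at exponent [k + 1] gives
    [y^(k+1) <= (k+1)! e m]; the spare factor [y] makes the quotient tend to zero. *)
Lemma harm_pow_lim k : is_lim_seq (fun M => / INR (S M) * harm (S M) ^ k) 0.
Proof.
  apply is_lim_seq_le_le with (u := fun _ => 0)
    (w := fun M => (INR (fact (S k)) * exp 1) * / (1 + ln (INR (S M)))).
  - intros M.
    assert (HM : 0 < INR (S M)) by (apply lt_0_INR; lia).
    pose proof (harm_le_ln (S M) ltac:(lia)) as Hl; pose proof (harm_ge_1 (S M) ltac:(lia)) as H1.
    pose proof (pow_le_exp (1 + ln (INR (S M))) (S k) ltac:(lra)) as He.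
    rewrite exp_plus, exp_ln in He by exact HM.
    pose proof (pow_incr (harm (S M)) (1 + ln (INR (S M))) k ltac:(lra)) as Hp.
    set (y := 1 + ln (INR (S M))) in *; set (m := INR (S M)) in *.
    split.
    { apply Rmult_le_pos; [left; apply Rinv_0_lt_compat, HM|apply pow_le; lra]. }
    apply Rmult_le_reg_l with (m * y); [apply Rmult_lt_0_compat; lra|].
    replace (m * y * (/ m * harm (S M) ^ k)) with (y * harm (S M) ^ k) by (field; lra).
    replace (m * y * (INR (fact (S k)) * exp 1 * / y)) with
      (INR (fact (S k)) * (exp 1 * m)) by (field; lra).
    apply Rle_trans with (2 := He); rewrite <- tech_pow_Rmult; apply Rmult_le_compat_l; lra.
  - apply is_lim_seq_const.
  - replace (Finite 0) with (Rbar_mult (INR (fact (S k)) * exp 1) 0) by (simpl; f_equal; ring).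
    apply is_lim_seq_scal_l.
    apply (is_lim_seq_inv _ p_infty); [|discriminate].
    apply (is_lim_seq_plus _ _ 1 p_infty); [apply is_lim_seq_const| |reflexivity].
    apply (is_lim_comp_seq ln (fun M => INR (S M)) p_infty p_infty); [apply is_lim_ln_p| |].
    + exists O; intros; discriminate.
    + apply (is_lim_seq_incr_1 INR), is_lim_seq_INR.
Qed.

(** * Limits *)

Lemma inv_pow_nonneg n k : 0 <= / (INR n ^ k).
Proof. rewrite <- pow_inv; apply pow_le, inv_INR_nonneg. Qed.

Lemma sum_range_le f g a c : (forall n, (a <= n < a + c)%nat -> f n <= g n) ->
  sum_range f a c <= sum_range g a c.
Proof.
  revert a; induction c as [|c IH]; intros a H; [apply Rle_refl|].
  rewrite !sum_range_S; apply Rplus_le_compat; [apply H; lia|].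
  apply IH; intros; apply H; lia.
Qed.

Lemma sum_range_0 a c : sum_range (fun _ => 0) a c = 0.
Proof.
  revert a; induction c as [|c IH]; intros a; [reflexivity|].
  rewrite sum_range_S, IH; ring.
Qed.

Lemma mzv_partial_nonneg m N l : 0 <= mzv_partial m N l.
Proof.
  revert m; induction l as [|k l IH]; intros m; [simpl; lra|].
  rewrite mzv_partial_cons, <- (sum_range_0 (S m) (N - m)); apply sum_range_le.
  intros n _; apply Rmult_le_pos; [apply inv_pow_nonneg|apply IH].
Qed.

(** The bound telescopes: [2/a - 2/(a+1) = 2/(a(a+1)) >= 1/a^2]. *)
Lemma sum_inv_sqr_le a c : (0 < a)%nat -> sum_range (fun n => / INR n ^ 2) a c <= 2 * / INR a.
Proof.
  revert a; induction c as [|c IH]; intros a Ha.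
  - unfold sum_range; simpl; pose proof (inv_INR_pos a Ha); lra.
  - rewrite sum_range_S; specialize (IH (S a) ltac:(lia)).
    assert (1 <= INR a) by (apply (le_INR 1); lia).
    apply Rle_trans with (/ INR a ^ 2 + 2 * / INR (S a)); [lra|].
    rewrite S_INR; apply Rmult_le_reg_l with (INR a ^ 2 * (INR a + 1)); [nra|].
    replace (INR a ^ 2 * (INR a + 1) * (/ INR a ^ 2 + 2 * / (INR a + 1))) with
      (INR a + 1 + 2 * INR a ^ 2) by (field; lra).
    replace (INR a ^ 2 * (INR a + 1) * (2 * / INR a)) with
      (2 * INR a * (INR a + 1)) by (field; lra).
    nra.
Qed.

Lemma mzv_partial_le m N l : all_ge2 l -> mzv_partial m N l <= 2 ^ length l.
Proof.
  intros Hl; revert m; induction Hl as [|k l Hk Hl IH]; intros m; [simpl; lra|].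
  rewrite mzv_partial_cons.
  apply Rle_trans with (sum_range (fun n => / INR n ^ 2 * 2 ^ length l) (S m) (N - m)).
  - apply sum_range_le; intros n Hn; apply Rmult_le_compat; [apply inv_pow_nonneg|
      apply mzv_partial_nonneg| |apply IH].
    assert (1 <= INR n) by (apply (le_INR 1); lia).
    apply Rinv_le_contravar; [apply pow_lt; lra|apply Rle_pow; assumption].
  - rewrite sum_range_mult_r; simpl pow; apply Rmult_le_compat_r; [apply pow_le; lra|].
    apply Rle_trans with (1 := sum_inv_sqr_le (S m) (N - m) ltac:(lia)).
    assert (1 <= INR (S m)) by (apply (le_INR 1); lia).
    rewrite <- (Rmult_1_r 2) at 2; apply Rmult_le_compat_l; [lra|].
    rewrite <- Rinv_1; apply Rinv_le_contravar; lra.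
Qed.

(** [zeta] is [real] of [Lim_seq], which is informative only for a finite limit; here the sums
    increase and are bounded. *)
Lemma mzv_partial_lim l : all_ge2 l -> is_lim_seq (fun M => mzv_partial 0 M l) (zeta l).
Proof.
  intros Hl; apply Lim_seq_correct', (ex_finite_lim_seq_incr _ (2 ^ length l)).
  - intros n; destruct l as [|j l _] using rev_ind; [simpl; lra|].
    rewrite mzv_partial_snoc by lia.
    pose proof (Rmult_le_pos _ _ (inv_pow_nonneg (S n) j) (mzv_partial_nonneg 0 n l)); lra.
  - intros n; apply mzv_partial_le, Hl.
Qed.

Lemma endsX_app u v : endsX v -> endsX (u ++ v).
Proof. intros H; induction u as [|a u IH]; [exact H|apply endsX_cons, IH]. Qed.

Lemma index_word_endsX ks : admissible ks -> endsX (index_word ks).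
Proof.
  induction ks as [|k ks IH]; intros (Hne & Hi & Hl); [congruence|].
  inversion_clear Hi as [|? ? Hk Hi']; cbn [index_word]; apply endsX_cons.
  destruct ks as [|k' ks].
  - simpl in Hl; replace (k - 1)%nat with (S (k - 2)) by lia.
    rewrite app_nil_r; apply allX_endsX; induction (k - 2)%nat as [|j IHj]; [reflexivity|exact IHj].
  - apply endsX_app, IH; repeat split; [discriminate|exact Hi'|exact Hl].
Qed.

Lemma index_word_adm ks : admissible ks -> adm (index_word ks).
Proof.
  intros H; pose proof (index_word_endsX ks H) as He.
  destruct ks; [left; reflexivity|apply adm_cons, endsX_tail_Y, He].
Qed.

Lemma length_index_word ks : is_index ks -> length (index_word ks) = weight ks.
Proof.
  induction 1 as [|k ks Hk _ IH]; [reflexivity|].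
  cbn [index_word length]; rewrite length_app, repeat_length, IH; simpl; lia.
Qed.

Lemma lincomb_lim (c : list (Z * mzindex)) :
  List.Forall (fun p => all_ge2 (snd p)) c ->
  is_lim_seq (fun M => fold_right Rplus 0 (map (fun p => IZR (fst p) * mzv_partial 0 M (snd p)) c))
    (fold_right Rplus 0 (map (fun p => IZR (fst p) * zeta (snd p)) c)).
Proof.
  induction 1 as [|p c Hp _ IH]; [apply is_lim_seq_const|].
  apply is_lim_seq_plus'; [|exact IH].
  apply (is_lim_seq_scal_l _ (IZR (fst p)) (zeta (snd p))), mzv_partial_lim, Hp.
Qed.

(** Convergence of the truncated sums of [ks] is part of the argument: they equal [gsum], hence
    [fsum] minus an error tending to zero, and [fsum] is an integral combination of convergent
    sums. *)
Lemma zeta_in_span ks : admissible ks ->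
  in_spanZ (fun l => all_ge2 l /\ weight l = weight ks) (zeta ks).
Proof.
  intros Hks; pose proof Hks as (_ & Hi & _).
  destruct (fsum_zspan _ (index_word_adm ks Hks)) as [c [Hc Ec]].
  rewrite length_index_word in Hc by exact Hi.
  exists c; split; [exact Hc|]; unfold zeta at 1.
  set (s := fold_right _ _ _).
  assert (H : is_lim_seq (fun M => mzv_partial 0 M ks) s);
    [|rewrite (is_lim_seq_unique _ _ H); reflexivity].
  set (w := index_word ks).
  apply is_lim_seq_ext with (u := fun M => fsum (S M) M w - (fsum (S M) M w - gsum (S M) M w)).
  { intros M; rewrite mzv_partial_gseries by exact Hi; unfold gsum, w; ring. }
  replace (Finite s) with (Finite (s - 0)) by (f_equal; ring).
  apply is_lim_seq_minus'.
  - apply is_lim_seq_ext with (1 := fun M => eq_sym (Ec M)), lincomb_lim.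
    refine (Forall_impl _ _ Hc); tauto.
  - apply is_lim_seq_le_le with (u := fun _ => 0)
      (w := fun M => (2 * INR (length w)) * (/ INR (S M) * harm (S M) ^ length w)).
    + intros M; rewrite <- Rmult_assoc; apply fsum_gsum; [apply index_word_endsX, Hks|lia].
    + apply is_lim_seq_const.
    + replace (Finite 0) with (Rbar_mult (2 * INR (length w)) 0) by (simpl; f_equal; ring).
      apply is_lim_seq_scal_l, harm_pow_lim.
Qed.

(** * Integral spans *)

Lemma in_spanZ_0 P : in_spanZ P 0.
Proof. exists []; split; [constructor|reflexivity]. Qed.

Lemma in_spanZ_plus P x y : in_spanZ P x -> in_spanZ P y -> in_spanZ P (x + y).
Proof.
  intros [c [Hc ->]] [d [Hd ->]]; exists (c ++ d); split; [apply Forall_app; auto|].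
  rewrite map_app, fold_right_app; clear; induction c as [|p c IH]; simpl; [ring|].
  rewrite <- IH; ring.
Qed.

Lemma in_spanZ_mult P z x : in_spanZ P x -> in_spanZ P (IZR z * x).
Proof.
  intros [c [Hc ->]]; exists (map (fun p => ((z * fst p)%Z, snd p)) c); split.
  - apply Forall_map; exact Hc.
  - clear; induction c as [|p c IH]; simpl; [ring|]; rewrite <- IH, mult_IZR; ring.
Qed.

Lemma in_spanZ_trans (P Q : mzindex -> Prop) x :
  (forall l, P l -> in_spanZ Q (zeta l)) -> in_spanZ P x -> in_spanZ Q x.
Proof.
  intros HPQ [c [Hc ->]]; induction Hc as [|p c Hp _ IH]; [apply in_spanZ_0|].
  apply in_spanZ_plus; [apply in_spanZ_mult, HPQ, Hp|exact IH].
Qed.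

Lemma in_spanZ_zeta (P : mzindex -> Prop) l : P l -> in_spanZ P (zeta l).
Proof.
  intros H; exists [(1%Z, l)]; split; [constructor; [exact H|constructor]|simpl; ring].
Qed.

(** * Enumeration of the indices without ones and collection of like terms *)

Fixpoint bounded_indices (n b : nat) : list mzindex :=
  match n with
  | O => [[]]
  | S n' => [] :: flat_map (fun l => map (fun j => j :: l) (List.seq 2 b)) (bounded_indices n' b)
  end.

Lemma in_bounded_indices n b l : (length l <= n)%nat ->
  List.Forall (fun j => (2 <= j < 2 + b)%nat) l -> In l (bounded_indices n b).
Proof.
  revert l; induction n as [|n IH]; intros [|j l] Hn Hl; simpl in Hn; [left; reflexivity|lia|
    left; reflexivity|right].
  inversion_clear Hl as [|? ? Hj Hl']; apply in_flat_map; exists l; split.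
  - apply IH; [lia|exact Hl'].
  - apply in_map_iff; exists j; split; [reflexivity|apply in_seq; lia].
Qed.

Lemma bounded_indices_ge2 n b l : In l (bounded_indices n b) -> all_ge2 l.
Proof.
  revert l; induction n as [|n IH]; intros l; [intros [<-|[]]; constructor|].
  intros [<-|H]; [constructor|]; apply in_flat_map in H as [l' [Hl' H]].
  apply in_map_iff in H as [j [<- Hj]]; apply in_seq in Hj.
  constructor; [lia|apply IH, Hl'].
Qed.

Lemma ge2_index_bounds l : all_ge2 l ->
  (length l <= weight l)%nat /\ List.Forall (fun j => (2 <= j < 2 + weight l)%nat) l.
Proof.
  induction 1 as [|j l Hj Hl [IH1 IH2]]; [split; [simpl; lia|constructor]|].
  change (weight (j :: l)) with (j + weight l)%nat; split; [cbn [length]; lia|].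
  constructor; [lia|]; refine (Forall_impl _ _ IH2); intros; lia.
Qed.

(** Complete because an index of weight [k] with entries at least two has at most [k] entries, none
    above [k]. *)
Definition ge2_indices (k : nat) : list mzindex :=
  nodup (list_eq_dec Nat.eq_dec)
    (filter (fun l => Nat.eqb (weight l) k) (bounded_indices k k)).

Lemma in_ge2_indices k l : In l (ge2_indices k) <-> all_ge2 l /\ weight l = k.
Proof.
  unfold ge2_indices; rewrite nodup_In, filter_In, Nat.eqb_eq; split; intros [H E];
    (split; [|exact E]).
  - eapply bounded_indices_ge2, H.
  - subst k; apply in_bounded_indices; apply ge2_index_bounds, H.
Qed.

(** A combination may list an index several times; its coefficients are added up. *)
Fixpoint index_coef (c : list (Z * mzindex)) (l : mzindex) : Z :=
  match c with
  | [] => 0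
  | p :: c' => (if list_eq_dec Nat.eq_dec l (snd p) then fst p else 0) + index_coef c' l
  end.

Lemma sum_index_coef (L : list mzindex) (c : list (Z * mzindex)) :
  NoDup L -> List.Forall (fun p => In (snd p) L) c ->
  fold_right Rplus 0 (map (fun p => IZR (fst p) * zeta (snd p)) c) =
  fold_right Rplus 0 (map (fun l => IZR (index_coef c l) * zeta l) L).
Proof.
  intros HL; induction 1 as [|p c Hp _ IH].
  - clear; induction L as [|l L IH]; [reflexivity|]; simpl in *; rewrite <- IH; ring.
  - cbn [map fold_right]; rewrite IH; clear IH.
    assert (Hsplit : forall L', fold_right Rplus 0 (map (fun l => IZR (index_coef (p :: c) l) * zeta l) L') =
      fold_right Rplus 0 (map (fun l => IZR (if list_eq_dec Nat.eq_dec l (snd p) then fst p else 0) * zeta l) L') +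
      fold_right Rplus 0 (map (fun l => IZR (index_coef c l) * zeta l) L')).
    { induction L' as [|l L' IH]; [simpl; ring|].
      cbn [map fold_right]; rewrite IH; cbn [index_coef]; rewrite plus_IZR; ring. }
    rewrite Hsplit; f_equal; clear Hsplit.
    (* As [L] has no duplicates, [snd p] matches a single entry and the others contribute zero. *)
    assert (Hout : forall L', ~ In (snd p) L' ->
      fold_right Rplus 0 (map (fun l => IZR (if list_eq_dec Nat.eq_dec l (snd p) then fst p else 0) * zeta l) L') = 0).
    { induction L' as [|l L' IH]; intros Hn; [reflexivity|].
      cbn [map fold_right]; rewrite IH by (intros H; apply Hn; right; exact H).
      destruct (list_eq_dec _ _ _) as [->|_]; [|ring].
      exfalso; apply Hn; left; reflexivity. }
    induction HL as [|l L Hl HL IH]; [destruct Hp|].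
    cbn [map fold_right]; destruct (list_eq_dec _ _ _) as [->|Hne].
    + rewrite Hout by exact Hl; ring.
    + rewrite <- IH by (destruct Hp; congruence || assumption); ring.
Qed.

Theorem mainTheorem1 :
  forall k : nat, (2 <= k)%nat ->
    (forall ks : mzindex, admissible ks -> weight ks = k ->
       exists (L : list mzindex) (c : mzindex -> Z),
         NoDup L /\
         (forall l, In l L <-> (all_ge2 l /\ weight l = k)) /\
         zeta ks = fold_right Rplus 0 (map (fun l => IZR (c l) * zeta l) L))
    /\
    (forall x : R,
       in_spanZ (fun l => admissible l /\ weight l = k) x <->
       in_spanZ (fun l => all_ge2 l /\ weight l = k) x).
Proof.
  intros k Hk; split.
  - intros ks Hks <-; destruct (zeta_in_span ks Hks) as [c [Hc Ec]].
    exists (ge2_indices (weight ks)), (index_coef c).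
    split; [apply NoDup_nodup|split; [apply in_ge2_indices|]].
    rewrite Ec; apply sum_index_coef; [apply NoDup_nodup|].
    refine (Forall_impl _ _ Hc); intros p; apply in_ge2_indices.
  - intros x; split; apply in_spanZ_trans; intros l [Hl <-].
    + apply zeta_in_span, Hl.
    + apply in_spanZ_zeta; split; [|reflexivity].
      (* The empty index has weight zero, which [2 <= k] excludes. *)
      assert (Hne : l <> []) by (intros ->; simpl in Hk; lia).
      repeat split; [exact Hne|refine (Forall_impl _ _ Hl); intros; lia|].
      destruct l as [|j l _] using rev_ind; [congruence|].
      rewrite last_last; apply Forall_app in Hl as [_ Hl]; inversion_clear Hl; assumption.
Qed.
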